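(* Let $n\ge 1$ be an integer and let $T_n$ be the triangular grid graph. For every integer $k$ with $0\le k\le |V(T_n)|$ and every $A\subseteq V(T_n)$ with $|A|=k$, \[ |\partial_{T_n}(A)|\ \ge\ \min\bigl\{\,|\partial_{T_n}(R_k)|,\ |\partial_{T_n}(I_k)|\,\bigr\}, \] where $R_k$ is the row packing of size $k$ and $I_k$ is the ice cream cone packing of size $k$.
   Context: The triangular grid graph $T_n$ (the $(n-1)$-th subdivision of a triangle) has vertex set $\{(v_1,v_2)\in\mathbb{Z}_{\ge 0}^2 : v_1+v_2\le n\}$, so $|V(T_n)|=\frac{(n+1)(n+2)}{2}$, and two vertices are adjacent iff they are of the form $(a,b),(a+1,b)$, or $(a,b),(a,b+1)$, or $(a+1,b),(a,b+1)$. Here $v_2$ is the index of the row containing $v$ (row $0$ is the bottom row, with $n+1$ vertices, and row $n$ is the single top vertex), and $v_1$ is the number of vertices of that row to the left of $v$. For a graph $G$ and $S\subseteq V(G)$, the vertex boundary $\partial_G(S)$ is the set of vertices not in $S$ that are adjacent to some vertex of $S$. The row packing of size $k$ is the set of the first $k$ vertices of $T_n$ in the order where $u$ precedes $v$ iff $u_2<v_2$, or $u_2=v_2$ and $u_1<v_1$ (i.e. rows are filled from the bottom up, each row only after the one below it is full, and each row from left to right). A set is the ice cream cone packing of size $k$ if it is the complement in $V(T_n)$ of the row packing of size $|V(T_n)|-k$. *)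

(* Defs.v *)
From mathcomp Require Import all_boot.

Set Implicit Arguments.
Unset Strict Implicit.
Unset Printing Implicit Defensive.

(* Both coordinates of a vertex of T_n are at most n, so they are taken in
   'I_n.+1 to get a finite type. *)
Definition tgrid (n : nat) : finType :=
  {v : 'I_n.+1 * 'I_n.+1 | v.1 + v.2 <= n}.

Section TriangularGrid.
Variable n : nat.
Implicit Types u v : tgrid n.

Definition pos v : nat := (val v).1.
Definition row v : nat := (val v).2.

(* The three disjuncts are (a,b),(a+1,b); (a,b),(a,b+1); (a+1,b),(a,b+1). *)
Definition tgrid_edge : rel (tgrid n) := fun u v =>
  [|| (pos v == (pos u).+1) && (row v == row u),
      (pos v == pos u) && (row v == (row u).+1)
    | (pos u == (pos v).+1) && (row v == (row u).+1)].

Definition tgrid_adj : rel (tgrid n) := fun u v =>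
  tgrid_edge u v || tgrid_edge v u.

Definition row_lt : rel (tgrid n) := fun u v =>
  (row u < row v) || (row u == row v) && (pos u < pos v).

(* A vertex is among the first k iff fewer than k vertices precede it. *)
Definition row_packing (k : nat) : {set tgrid n} :=
  [set v | #|[set u | row_lt u v]| < k].

Definition icecream_packing (k : nat) : {set tgrid n} :=
  ~: row_packing (#|tgrid n| - k).

End TriangularGrid.

Definition vertex_boundary (V : finType) (adj : rel V) (S : {set V}) : {set V} :=
  [set v | (v \notin S) && [exists u in S, adj u v]].

(* Main.v *)
Require Import Defs.
From mathcomp Require Import all_boot.
From mathcomp Require Import zify.

Set Implicit Arguments.
Unset Strict Implicit.
Unset Printing Implicit Defensive.

(** Write [m] for the size of the boundary of [A]. It is
enough that every [A] satisfies [|A| <= m(m-1)/2] (then the ice cream cone packing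
has boundary at most [m]) or [|V \ A| <= m(m+1)/2] (then the row packing has).
Pushing every row of [A] to the left, then every column down, keeps [|A|] and
does not enlarge the closed neighbourhood, so [A] may be taken to be a down-set.
If a down-set misses the hypotenuse [v1 + v2 = n], a point [(x, y)] of it forces
a boundary vertex in each of the rows [0..y] and, above row [y], in each of the
columns [0..x]; hence [A] lies in the triangle [v1 + v2 <= m - 2]. If it meets
the hypotenuse, the same count shows that at most [m] points of the hypotenuse
are missing, and every missing vertex is determined by the two missing
hypotenuse points at the ends of its row and of its column. *)

(** * Counting in initial segments of the naturals *)

Definition cnt (N : nat) (X : pred nat) : nat := \sum_(x < N) X x.

Lemma cnt0 X : cnt 0 X = 0.
Proof. exact: big_ord0. Qed.

Lemma cntS N X : cnt N.+1 X = cnt N X + X N.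
Proof. exact: big_ord_recr. Qed.

Lemma eq_cnt N (X Y : pred nat) :
  (forall x, x < N -> X x = Y x) -> cnt N X = cnt N Y.
Proof. by move=> h; apply: eq_bigr => x _; rewrite h. Qed.

Lemma leq_cnt N (X Y : pred nat) :
  (forall x, x < N -> X x -> Y x) -> cnt N X <= cnt N Y.
Proof. by move=> h; apply: leq_sum => x _; case E: (X x) => //; rewrite h. Qed.

Lemma cnt_ltn N c : cnt N (fun x => x < c) = minn c N.
Proof. by elim: N => [|N IH]; rewrite ?cnt0 ?minn0 // cntS IH; lia. Qed.

Lemma cnt_bound N c (X : pred nat) :
  (forall x, x < N -> X x -> x < c) -> cnt N X <= c.
Proof.
move=> h; apply: leq_trans (geq_minl c N); rewrite -cnt_ltn.
exact: leq_cnt.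
Qed.

Lemma cnt_le_size N X : cnt N X <= N.
Proof. exact: cnt_bound. Qed.

Lemma cnt_gt0P N (X : pred nat) :
  reflect (exists2 x, x < N & X x) (0 < cnt N X).
Proof.
rewrite lt0n sum_nat_eq0; apply: (iffP idP).
  by case/forallPn=> x; rewrite /= eqb0 negbK; exists (x : nat).
by case=> x xN Xx; apply/forallPn; exists (Ordinal xN); rewrite /= eqb0 Xx.
Qed.

Lemma ltn_cnt N (X Y : pred nat) x0 :
  (forall x, x < N -> X x -> Y x) -> x0 < N -> ~~ X x0 -> Y x0 ->
  cnt N X < cnt N Y.
Proof.
move=> h x0N nX Yx; rewrite /cnt.
rewrite (bigD1 (Ordinal x0N)) // [ltnRHS](bigD1 (Ordinal x0N)) //=.
rewrite (negbTE nX) Yx add0n add1n ltnS.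
by apply: leq_sum => x _; case E: (X x) => //; rewrite h.
Qed.

Lemma cnt_widen L M X : L <= M -> cnt L X <= cnt M X.
Proof.
move=> /subnKC <-; elim: (M - L) => [|d IH]; first by rewrite addn0.
by rewrite addnS cntS; apply: leq_trans (leq_addr _ _).
Qed.

Lemma cnt_support L M (X : pred nat) : L <= M ->
  (forall x, X x -> x < L) -> cnt M X = cnt L X.
Proof.
move=> /subnKC <- h; elim: (M - L) => [|d IH]; first by rewrite addn0.
rewrite addnS cntS IH; case E: (X _); last by rewrite addn0.
by have := h _ E; rewrite ltnNge leq_addr.
Qed.

Lemma cnt_full N (X : pred nat) : cnt N X = N -> forall x, x < N -> X x.
Proof.
move=> e x xN; case E: (X x) => //.
have := @ltn_cnt N X predT x (fun _ _ _ => isT) xN (negbT E) isT.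
by rewrite e ltnNge cnt_le_size.
Qed.

(** * Neighbourhoods along and between consecutive rows *)

(** A row of [L.+1] points seen from the row of [L] points above it, where [x] touches [x] and
    [x.+1] below. Size is lost only when the lower row is full. *)
Lemma cnt_up_neighbours L (X : pred nat) :
  minn (cnt L.+1 X) L <= cnt L (fun x => X x || X x.+1).
Proof.
elim: L => [|L IH]; first by rewrite minn0.
rewrite cntS [leqRHS]cntS; case E: (X L.+1).
  by rewrite orbT /=; lia.
rewrite orbF; case: (ltngtP (cnt L.+1 X) L.+1) => h.
- by case: (X L); lia.
- by have := cnt_le_size L.+1 X; lia.
- by rewrite (cnt_full h) //; lia.
Qed.

(** A row of [L] points seen from the longer row below it, where [x] touches [x] and [x.-1] above.
    The last point of [X] contributes an extra neighbour to its right. *)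
Lemma cnt_down_neighbours L (X : pred nat) : 0 < cnt L X ->
  cnt L X < cnt L.+1 (fun x => X x || (0 < x) && X x.-1).
Proof.
elim: L => [|L IH]; first by rewrite cnt0.
rewrite (cntS L X) (cntS L.+1) /=.
case: (posnP (cnt L X)) => [e|/IH].
  rewrite e add0n; case E: (X L) => // _.
  by rewrite cntS E orbT /=; lia.
by case: (X L); rewrite ?orbT /=; lia.
Qed.

(** A set that is neither empty nor full has a point next to it inside the row. *)
Lemma cnt_side_neighbours L (X : pred nat) : 0 < cnt L X < L ->
  cnt L X < cnt L (fun x => [|| X x, X x.+1 | (0 < x) && X x.-1]).
Proof.
move=> h.
suff [x xL /andP[nX nb]] : exists2 x, x < L &
    ~~ X x && (X x.+1 || (0 < x) && X x.-1).
  by apply: ltn_cnt xL nX _; [move=> z _ -> | rewrite nb orbT].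
(* Either the gap already occurs below [L], or [X] is empty there and the witness is [L.-1], or [X]
   is full there and the witness is [L]. *)
elim: L h => [|L IH]; first by rewrite cnt0.
rewrite cntS; case: (boolP (0 < cnt L X < L)) => [/IH[x xL Hx] _|].
  by exists x => //; apply: ltnW.
have sL := cnt_le_size L X.
case: (posnP (cnt L X)) => [e _|s0 Ls].
  rewrite e; case E: (X L) => // L0; exists L.-1; first by lia.
  rewrite prednK ?E ?andbT; last by lia.
  apply/negP => XL.
  have : 0 < cnt L X by apply/cnt_gt0P; exists L.-1 => //; lia.
  by rewrite e.
have e : cnt L X = L by lia.
have L0 : 0 < L by lia.
rewrite e; case E: (X L); first by lia.
move=> _.
by exists L => //; rewrite E L0 (@cnt_full L X e L.-1) ?andbT ?orbT //; lia.
Qed.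

(** * Triangular numbers *)

(** Doubled to avoid division; terms with [y >= m] vanish by truncated subtraction. *)
Lemma sum_triangle N m : m <= N -> (\sum_(y < N) (m - y)) * 2 = m * m.+1.
Proof.
elim: N m => [|N IH] [|m] // h; first by rewrite big_ord0.
  by rewrite big1.
rewrite big_ord_recl subn0.
rewrite (eq_bigr (fun y : 'I_N => m - y)) //.
by rewrite mulnDl IH //; lia.
Qed.

Lemma sum_triangle_le N m : (\sum_(y < N) (m - y)) * 2 <= m * m.+1.
Proof.
rewrite -(@sum_triangle (maxn N m) m) ?leq_maxr // leq_mul2r /=.
rewrite -(subnKC (leq_maxl N m)) big_split_ord /=.
exact: leq_addr.
Qed.

(** Adding the same sum with [y] and [z] exchanged counts every pair once and the diagonal twice. *)
Lemma sum_ordered_pairs N (f : pred nat) :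
  (\sum_(y < N) cnt N (fun z => [&& y <= z, f y & f z])) * 2
    = cnt N f * (cnt N f).+1.
Proof.
rewrite /cnt muln2 -addnn {2}exchange_big -big_split /= mulnS
  big_distrl -big_split /=.
apply: eq_bigr => y _; rewrite -big_split big_distrr /= (bigD1 y) //=.
rewrite [in RHS](bigD1 y) //= leqnn.
rewrite addnA; congr (_ + _); first by case: (f y).
apply: eq_bigr => z; rewrite -val_eqE /=; case: (f y); case: (f z); lia.
Qed.

(** * Compression to a down-set *)

Section Compression.
Variable n : nat.
Implicit Types P Q D : nat -> nat -> bool.

Definition supported P := forall x y, P x y -> x + y <= n.

Definition transpose P x y := P y x.

Definition row_size P y := cnt n.+1 (fun x => P x y).

Definition area P := \sum_(y < n.+1) row_size P y.

(** The vertex and its six neighbours; since [0.-1] is [0], the guards keep [x.-1] and [y.-1]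
    genuine predecessors. *)
Definition closed_nbhd P x y :=
  (x + y <= n) && [|| P x y, P x.+1 y, P x y.+1,
    (0 < x) && P x.-1 y, (0 < y) && P x y.-1,
    (0 < y) && P x.+1 y.-1 | (0 < x) && P x.-1 y.+1].

Definition compress P x y := x < row_size P y.

Lemma area_transpose P : area (transpose P) = area P.
Proof. exact: exchange_big. Qed.

(** Swapping the coordinates is an automorphism of the grid, so it permutes the six neighbours. *)
Lemma closed_nbhd_transpose P x y :
  closed_nbhd (transpose P) x y = transpose (closed_nbhd P) x y.
Proof.
rewrite /closed_nbhd /transpose addnC; congr (_ && _).
move: (P y x) (P y.+1 x) (P y x.+1) ((0 < y) && P y.-1 x)
  ((0 < x) && P y x.-1) ((0 < x) && P y.+1 x.-1) ((0 < y) && P y.-1 x.+1).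
by do 7![case].
Qed.

Lemma row_size_bound P y : supported P -> row_size P y <= n.+1 - y.
Proof. by move=> sP; apply: cnt_bound => x _ /sP; lia. Qed.

Lemma row_size_support P y : supported P ->
  row_size P y = cnt (n.+1 - y) (fun x => P x y).
Proof. by move=> sP; apply: cnt_support => [|x /sP]; lia. Qed.

Lemma supported_compress P : supported P -> supported (compress P).
Proof. by move=> sP x y; have := row_size_bound y sP;
  rewrite /compress; lia. Qed.

Lemma row_size_compress P y : row_size (compress P) y = row_size P y.
Proof.
rewrite {1}/row_size /compress cnt_ltn; apply/minn_idPl.
exact: cnt_le_size.
Qed.

Lemma area_compress P : area (compress P) = area P.
Proof. by apply: eq_bigr => y _; rewrite row_size_compress. Qed.

(** Row by row: after compression, the rows [y.-1], [y] and [y.+1] each cover an initial segment of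
    row [y], so it suffices that [c] is at least the length of each segment. *)
Lemma area_closed_nbhd_compress P : supported P ->
  area (closed_nbhd (compress P)) <= area (closed_nbhd P).
Proof.
move=> sP; apply: leq_sum => -[y yn] _ /=; set c := row_size (closed_nbhd P) y.
have wc L (X : pred nat) : L <= n.+1 - y ->
    (forall x, x < L -> X x -> closed_nbhd P x y) -> cnt L X <= c.
  move=> Ln h; apply: (@leq_trans (cnt L (closed_nbhd P ^~ y))).
    exact: leq_cnt.
  by apply: cnt_widen; lia.
(* [F0] and [F1] treat row [y] itself, [F2] the row below and [F3] the row above. *)
have F0 : row_size P y <= c.
  rewrite row_size_support //; apply: wc => // x xl Px.
  by rewrite /closed_nbhd Px /= andbT; lia.
have F1 : 0 < row_size P y < n.+1 - y -> row_size P y < c.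
  rewrite row_size_support // => /cnt_side_neighbours h.
  apply: leq_trans h _; apply: wc => // x xl; rewrite /closed_nbhd => h.
  by apply/andP; split; [lia | case/or3P: h => ->; rewrite ?orbT].
have F2 : 0 < y -> minn (row_size P y.-1) (n.+1 - y) <= c.
  move=> y0; rewrite row_size_support //.
  have -> : n.+1 - y.-1 = (n.+1 - y).+1 by lia.
  apply: leq_trans (cnt_up_neighbours _ _) _; apply: wc => // x xl.
  rewrite /closed_nbhd y0 => h.
  by apply/andP; split; [lia | case/orP: h => ->; rewrite ?orbT].
have F3 : 0 < row_size P y.+1 -> row_size P y.+1 < c.
  rewrite row_size_support // => h0.
  have yn' : y < n.
    rewrite ltnNge; apply/negP => ny; move: h0.
    by rewrite (_ : n.+1 - y.+1 = 0) ?cnt0 //; lia.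
  apply: leq_trans (cnt_down_neighbours h0) _.
  apply: wc => [|x xl h]; first by lia.
  apply/andP; split; first by lia.
  by case/orP: h => ->; rewrite ?orbT.
have Bl := row_size_bound y sP.
apply: cnt_bound => x _ /andP[xy]; rewrite /compress.
by case/or4P; [| | |case/or4P]; lia.
Qed.

Definition down_closed D :=
  forall x y x' y', x' <= x -> y' <= y -> D x y -> D x' y'.

(* The columns of the left-justified [compress P] have decreasing sizes, so one
   compression in each direction suffices. *)
Lemma down_closed_compression P : supported P -> exists D,
  [/\ supported D, down_closed D, area D = area P
    & area (closed_nbhd D) <= area (closed_nbhd P)].
Proof.
move=> sP; set Q := transpose (compress P).
have sC := supported_compress sP.
have sQ : supported Q by move=> x y /sC; rewrite addnC.
exists (transpose (compress Q)); split.
- by move=> x y /(supported_compress sQ); rewrite addnC.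
- move=> x y x' y' lx ly; rewrite /transpose /compress => h.
  apply: leq_ltn_trans ly (leq_trans h _).
  by apply: leq_cnt => z _; apply: leq_ltn_trans.
- by rewrite area_transpose area_compress area_transpose area_compress.
- have E P' : area (closed_nbhd (transpose P')) = area (closed_nbhd P').
    rewrite -[RHS]area_transpose; apply: eq_bigr => y _; apply: eq_cnt => x _.
    exact: closed_nbhd_transpose.
  rewrite E; apply: leq_trans (area_closed_nbhd_compress sQ) _.
  by rewrite E area_closed_nbhd_compress.
Qed.

(* For a down-set [D]: row [j] is not full, equivalently column [n - j] is not. *)
Definition defect D j := ~~ D (n - j) j.

(** * Boundaries of down-sets *)

Lemma leq_area P Q :
  (forall x y, x <= n -> y <= n -> P x y -> Q x y) -> area P <= area Q.
Proof.
move=> h; apply: leq_sum => y _; apply: leq_cnt => x xn.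
by apply: h => //; rewrite -ltnS.
Qed.

Lemma areaU P Q : (forall x y, ~~ (P x y && Q x y)) ->
  area (fun x y => P x y || Q x y) = area P + area Q.
Proof.
move=> h; rewrite /area -big_split /=; apply: eq_bigr => y _.
rewrite /row_size /cnt -big_split /=; apply: eq_bigr => x _.
by have := h x y; case: (P x y); case: (Q x y).
Qed.

Definition boundary D x y := closed_nbhd D x y && ~~ D x y.

Lemma area_boundary D : supported D ->
  area (closed_nbhd D) = area D + area (boundary D).
Proof.
move=> sD; rewrite -areaU => [|x y]; last first.
  by rewrite /boundary; case: (D x y); rewrite ?andbF.
apply: eq_bigr => y _; apply: eq_cnt => x _; rewrite /boundary.
case E: (D x y); rewrite ?andbT //= /closed_nbhd E andbT.
exact: sD.
Qed.

Lemma boundary_transpose D x y : boundary (transpose D) x y = boundary D y x.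
Proof. by rewrite /boundary closed_nbhd_transpose. Qed.

(** The first vertex of row [j] missing from [D] works: its left neighbour is in [D], and [defect]
    keeps it inside the row. *)
Lemma boundary_in_row D x j : down_closed D -> D x j -> defect D j -> j <= n ->
  exists2 i, x < i <= n & boundary D i j.
Proof.
move=> dD Dx df jn.
have [i ni imin] := ex_minnP (ex_intro (fun z => ~~ D z j) _ df).
have xi : x < i by rewrite ltnNge; apply: contra ni => /dD/(_ (leqnn j) Dx).
have le_i := imin _ df.
exists i; first by rewrite xi; lia.
have Di : D i.-1 j by case: (boolP (D i.-1 j)) => // /imin; lia.
rewrite /boundary ni andbT /closed_nbhd; apply/andP; split; first by lia.
by rewrite Di (leq_ltn_trans _ xi) ?orbT.
Qed.

Lemma boundary_in_column D i y : down_closed D -> D i y -> defect D (n - i) ->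
  i <= n -> exists2 j, y < j <= n & boundary D i j.
Proof.
move=> dD Di df iN.
have dT : down_closed (transpose D) by move=> ? ? ? ? lx ly; apply: dD.
have [|j yj bj] := boundary_in_row dT Di _ iN.
  by move: df; rewrite /defect subKn.
by exists j => //; rewrite -boundary_transpose.
Qed.

(** [U] gets a boundary vertex from each defective row up to [y], and [W] one from each defective
    column up to [x]. They are disjoint because [W] lies above row [y]. *)
Lemma area_boundary_lower D x y : down_closed D -> x <= n -> y <= n -> D x y ->
  cnt n.+1 (fun j => (j <= y) && defect D j)
    + cnt n.+1 (fun i => (i <= x) && defect D (n - i)) <= area (boundary D).
Proof.
move=> dD xn yn Dxy.
pose U i j := (j <= y) && boundary D i j.
pose W i j := [&& i <= x, y < j & boundary D i j].
apply: (@leq_trans (area (fun i j => U i j || W i j))); last first.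
  by apply: leq_area => i j _ _; rewrite /U /W => /orP[/andP[]|/and3P[]].
rewrite areaU => [|i j]; last by rewrite /U /W; lia.
rewrite -(area_transpose W); apply: leq_add; apply: leq_sum => -[j jn] _ /=.
  case: (boolP (_ && _)) => // /andP[jy df].
  have [i /andP[_ iN] bi] := boundary_in_row dD (dD _ _ _ _ (leqnn x) jy Dxy) df jn.
  by apply/cnt_gt0P; exists i; rewrite // /U jy.
case: (boolP (_ && _)) => // /andP[jx df].
have [i /andP[yi iN] bi] := boundary_in_column dD (dD _ _ _ _ jx (leqnn y) Dxy) df jn.
by apply/cnt_gt0P; exists i; rewrite // /transpose /W jx yi.
Qed.

Lemma cnt_rev (X : pred nat) : cnt n.+1 (fun i => X (n - i)) = cnt n.+1 X.
Proof.
rewrite /cnt (reindex_inj rev_ord_inj) /=; apply: eq_bigr => i _.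
by rewrite subSS subKn // -ltnS.
Qed.

(** All of the [y.+1] rows and [x.+1] columns are defective, so [D] lies in a triangle whose row [y]
    has [m.-1 - y] vertices. *)
Lemma area_no_full_row D : supported D -> down_closed D ->
  (forall j, j <= n -> defect D j) ->
  area D * 2 <= area (boundary D) * (area (boundary D)).-1.
Proof.
move=> sD dD df; set m := area (boundary D).
have in_tri x y : D x y -> x + y + 2 <= m.
  move=> Dxy; have xyn := sD _ _ Dxy.
  have xn : x <= n by lia.
  have yn : y <= n by lia.
  apply: leq_trans (area_boundary_lower dD xn yn Dxy).
  have dfc z (X : nat -> nat) : z <= n -> (forall j, j <= n -> X j <= n) ->
      cnt n.+1 (fun j => (j <= z) && defect D (X j)) = z.+1.
    move=> zn hX; rewrite -[RHS](minn_idPl (_ : z.+1 <= n.+1)) // -cnt_ltn.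
    by apply: eq_cnt => j jn; rewrite df ?andbT // hX.
  rewrite (dfc y id) // (dfc x (subn n)) // => [|j _]; last by lia.
  by lia.
have le_row y : row_size D y <= m.-1 - y.
  by apply: cnt_bound => x _ /in_tri; lia.
apply: (@leq_trans ((\sum_(y < n.+1) (m.-1 - y)) * 2)).
  by rewrite leq_mul2r /=; apply: leq_sum => y _; apply: le_row.
apply: leq_trans (sum_triangle_le _ _) _; rewrite mulnC.
by case: (m).
Qed.

(* A vertex [(x, y)] outside [D] is sent to the pair [(y, n - x)] of its row and
   the row where its column ends, neither of which is full. *)
Lemma area_compl_full_row D i : supported D -> down_closed D -> i <= n ->
  D (n - i) i ->
  area (fun x y => (x + y <= n) && ~~ D x y) * 2
    <= area (boundary D) * (area (boundary D)).+1.
Proof.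
move=> sD dD iN Di; set h := cnt n.+1 (defect D).
have hm : h <= area (boundary D).
  (* Columns [0..n - i] end in rows [i..n], so together with rows [0..i] they account for every
     defective row. *)
  apply: leq_trans (area_boundary_lower dD (leq_subr i n) iN Di).
  have -> : cnt n.+1 (fun j => (j <= n - i) && defect D (n - j))
          = cnt n.+1 (fun j => (i <= j) && defect D j).
    rewrite -[RHS]cnt_rev; apply: eq_cnt => j jn; congr (_ && _); lia.
  rewrite /h /cnt -big_split /=; apply: leq_sum => j _.
  by case: (defect D j); rewrite ?andbF // !andbT; lia.
apply: (@leq_trans (h * h.+1)); last by apply: leq_mul.
rewrite -sum_ordered_pairs leq_mul2r /=; apply: leq_sum => -[y yn] _ /=.
rewrite -[leqRHS]cnt_rev; apply: leq_cnt => x xn /andP[xy nD].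
(* Both [(n - y, y)] and [(x, n - x)] dominate [(x, y)], so neither is in the down-set. *)
apply/and3P; split; first by lia.
  by apply: contra nD; apply: dD; lia.
by apply: contra nD; rewrite subKn //; apply: dD; lia.
Qed.

Lemma area_dichotomy P : supported P ->
  let m := area (closed_nbhd P) - area P in
  area P * 2 <= m * m.-1
  \/ area (fun x y => (x + y <= n) && ~~ P x y) * 2 <= m * m.+1.
Proof.
move=> sP m.
have areaC (Q : nat -> nat -> bool) : supported Q ->
    area Q + area (fun x y => (x + y <= n) && ~~ Q x y)
      = area (fun x y => x + y <= n).
  move=> sQ; rewrite -areaU => [|x y]; last by case: (Q x y); rewrite ?andbF.
  apply: eq_bigr => y _; apply: eq_cnt => x _.
  by case E: (Q x y); rewrite ?andbT //= sQ.
have [D [sD dD eA leN]] := down_closed_compression sP.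
(* Both bounds grow with the boundary size, so they may be proved for [D] and then relaxed to
   [m]. *)
have bdm : area (boundary D) <= m by rewrite area_boundary // in leN; rewrite /m; lia.
have eC : area (fun x y => (x + y <= n) && ~~ P x y)
    = area (fun x y => (x + y <= n) && ~~ D x y).
  by have := areaC _ sP; have := areaC _ sD; lia.
rewrite eC -eA.
case: (boolP [exists i : 'I_n.+1, D (n - i) i]) => [/existsP[i Di]|nF].
  right; apply: leq_trans (area_compl_full_row sD dD (ltn_ord i : i <= n) Di) _.
  by apply: leq_mul.
left; apply: leq_trans (area_no_full_row sD dD _) _ => [j jn|].
  by move: nF; rewrite negb_exists => /forallP/(_ (inord j)); rewrite inordK.
by apply: leq_mul; lia.
Qed.

End Compression.

Lemma cnt_interval N a b : cnt N (fun x => a <= x < b) = minn b N - a.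
Proof. by elim: N => [|N IH]; rewrite ?cnt0 ?minn0 ?sub0n // cntS IH; lia. Qed.

(** * Transfer to the graph *)

Section Grid.
Variable n : nat.
Implicit Types (u v w : tgrid n) (A B : {set tgrid n}).

Lemma pos_row_le v : pos v + row v <= n.
Proof. exact: (valP v). Qed.

Lemma tgrid_inj u v : pos u = pos v -> row u = row v -> u = v.
Proof.
move=> e1 e2; apply: val_inj; move: e1 e2; rewrite /pos /row.
by case: (val u) (val v) => [a b] [c d] /= /val_inj -> /val_inj ->.
Qed.

Definition region (P : nat -> nat -> bool) : {set tgrid n} :=
  [set v | P (pos v) (row v)].

Lemma card_region P :
  #|region P| = area n (fun x y => (x + y <= n) && P x y).
Proof.
rewrite -(card_imset _ val_inj) /area /row_size /cnt exchange_big pair_bigA /=.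
rewrite -sum1_card big_mkcond; apply: eq_bigr => -[x y] _ /=.
rewrite (_ : _ \in _ = (x + y <= n) && P x y); first by case: (_ && _).
apply/imsetP/andP => [[v]|[xy Pxy]].
  rewrite inE => Pv e.
  by have := pos_row_le v; move: Pv; rewrite /pos /row /= -e.
by exists (exist _ (x, y) xy); rewrite // inE.
Qed.

Lemma card_region_supported B P : supported n P ->
  (forall v, (v \in B) = P (pos v) (row v)) -> #|B| = area n P.
Proof.
move=> sP BP; have -> : B = region P by apply/setP=> v; rewrite inE BP.
rewrite card_region; apply: eq_bigr => y _; apply: eq_cnt => x _.
by case E: (P x y); rewrite ?andbF // sP.
Qed.

Definition coords A x y := [exists v in A, (pos v == x) && (row v == y)].

Lemma coordsP A x y :
  reflect (exists v, [/\ v \in A, pos v = x & row v = y]) (coords A x y).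
Proof.
apply: (iffP existsP) => -[v]; first by case/and3P=> vA /eqP ? /eqP ?; exists v.
by case=> vA ex ey; exists v; rewrite vA ex ey !eqxx.
Qed.

Lemma coordsE A v : coords A (pos v) (row v) = (v \in A).
Proof.
apply/coordsP/idP => [[u [uA e1 e2]]|vA]; last by exists v.
by rewrite -(tgrid_inj e1 e2).
Qed.

Lemma supported_coords A : supported n (coords A).
Proof. by move=> x y /coordsP[v [_ <- <-]]; apply: pos_row_le. Qed.

(** The six offsets of [closed_nbhd] are the three edge types, each read in both directions. *)
Lemma closed_nbhd_coords A v :
  closed_nbhd n (coords A) (pos v) (row v)
    = (v \in A) || (v \in vertex_boundary (@tgrid_adj n) A).
Proof.
rewrite /closed_nbhd pos_row_le coordsE inE; case vA: (v \in A) => //=.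
apply/idP/existsP => [h|[u /andP[uA]]]; last first.
  have cu : coords A (pos u) (row u) by rewrite coordsE.
  case/orP; case/or3P=> /andP[/eqP e1 /eqP e2]; move: cu; rewrite ?e1 ?e2 => cu;
    by rewrite ?cu ?orbT //; move: cu; rewrite -?e1 -?e2 => ->; rewrite ?orbT.
suff [u [uA hu]] : exists u, u \in A /\ tgrid_adj u v by exists u; rewrite uA.
rewrite /tgrid_adj /tgrid_edge.
case/or4P: h => [| | |/or3P[]]; try case/andP=> ?;
  case/coordsP=> u [uA eu1 eu2]; exists u; split=> //; lia.
Qed.

Lemma card_vertex_boundary A :
  #|vertex_boundary (@tgrid_adj n) A|
    = area n (closed_nbhd n (coords A)) - area n (coords A).
Proof.
have <- : #|A| = area n (coords A).
  by apply: card_region_supported => [|v];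
    [exact: supported_coords | rewrite coordsE].
have <- : #|A :|: vertex_boundary (@tgrid_adj n) A|
    = area n (closed_nbhd n (coords A)).
  apply: card_region_supported => [x y /andP[] //|v].
  by rewrite in_setU closed_nbhd_coords.
rewrite cardsU (_ : A :&: _ = set0) ?cards0 ?subn0 ?addKn //.
by apply/setP=> v; rewrite !inE; case: (v \in A).
Qed.

Lemma separation_dichotomy A :
  let m := #|vertex_boundary (@tgrid_adj n) A| in
  #|A| * 2 <= m * m.-1 \/ #|~: A| * 2 <= m * m.+1.
Proof.
move=> m.
rewrite (@card_region_supported A (coords A)); last first.
- by move=> v; rewrite coordsE.
- exact: supported_coords.
rewrite (@card_region_supported (~: A)
  (fun x y => (x + y <= n) && ~~ coords A x y)); last first.
- by move=> v; rewrite inE coordsE pos_row_le.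
- by move=> x y /andP[].
rewrite /m card_vertex_boundary.
exact/area_dichotomy/supported_coords.
Qed.

(** * Boundaries of the two packings *)

(** Position in the filling order: [row_packing n k] consists of the vertices of rank below [k]. *)
Definition rank v := #|[set u | @row_lt n u v]|.

Lemma leq_rank u v : ~~ row_lt v u -> rank u <= rank v.
Proof.
move=> h; apply: subset_leq_card; apply/subsetP=> w.
by move: h; rewrite !inE /row_lt; lia.
Qed.

(** These rows form a smaller triangle; it is summed by columns, column [x] having [n - row v - x]
    of its vertices. *)
Lemma card_above v :
  #|[set w : tgrid n | row v < row w]| * 2 = (n - row v) * (n - row v).+1.
Proof.
rewrite -(@sum_triangle n.+1); last by lia.
congr (_ * _); rewrite (card_region (fun _ y => row v < y)) -area_transpose.
apply: eq_bigr => -[x xn] _ /=.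
rewrite /row_size /transpose.
rewrite (@eq_cnt _ _ (fun y => (row v).+1 <= y < n.+1 - x));
  last by move=> y _; lia.
by rewrite cnt_interval; lia.
Qed.

(** The predecessors of [v], [v] itself and the vertices in higher rows are disjoint. *)
Lemma rank_bound v :
  (rank v).+1 * 2 + (n - row v) * (n - row v).+1 <= #|tgrid n| * 2.
Proof.
rewrite -card_above -mulnDl leq_mul2r /= /rank.
rewrite -[#|tgrid n|](cardsC [set w : tgrid n | row v < row w]) addnC leq_add2l.
have := cardsU1 v [set u | row_lt u v].
rewrite inE (_ : row_lt v v = false) ?add1n => [<-|];
  last by rewrite /row_lt; lia.
apply: subset_leq_card; apply/subsetP=> w; rewrite !inE /row_lt.
by case/orP=> [/eqP->|]; lia.
Qed.

(** The second hypothesis, applied both ways, leaves at most one vertex of [B] for each value of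
    [pos]. *)
Lemma card_pos_inj B m : (forall v, v \in B -> pos v < m) ->
  (forall u v, u \in B -> v \in B -> pos u = pos v -> row v <= row u) ->
  #|B| <= m.
Proof.
move=> lt_m inj.
have injB : {in B &, injective (fun v => (val v).1)}.
  move=> u v uB vB /(congr1 val) /= e; apply: tgrid_inj => //.
  by apply/eqP; rewrite eqn_leq !inj.
rewrite -(card_in_imset injB).
apply: (@leq_trans (cnt n.+1 (fun x => x < m)));
  last by rewrite cnt_ltn geq_minl.
rewrite -sum1_card big_mkcond; apply: leq_sum => x _.
case: ifP => // /imsetP[v vB ->].
by have := lt_m _ vB; rewrite /pos => ->.
Qed.

Lemma card_boundary_row_packing k m : k <= #|tgrid n| ->
  (#|tgrid n| - k) * 2 <= m * m.+1 ->
  #|vertex_boundary (@tgrid_adj n) (row_packing n k)| <= m.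
Proof.
move=> kN hk; apply: card_pos_inj => [v|u v].
  rewrite !inE -/(rank v) -leqNgt => /andP[kv _].
  have := rank_bound v; have := pos_row_le v; set r := n - row v => pv rv.
  (* As [pos v <= r], it suffices to bound [r]; [rank_bound] with [k <= rank v] gives
     [r * r.+1 < m * m.+1]. *)
  suff : r < m by rewrite /r; lia.
  rewrite ltnNge; apply/negP => mr.
  have : m * m.+1 <= r * r.+1 by apply: leq_mul.
  by lia.
rewrite !inE -/(rank u) -/(rank v) -!leqNgt => /andP[ku _].
case/andP=> _ /existsP[w /andP[]]; rewrite inE -/(rank w) => wk adj epos.
rewrite leqNgt; apply/negP => ruv.
(* A neighbour [w] of the higher vertex [v] does not precede [u], which has the same [pos] in a
   lower row; so [w] in the packing would force [u] into it. *)
suff /leq_rank : ~~ row_lt w u by lia.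
by move: adj; rewrite /tgrid_adj /tgrid_edge /row_lt; lia.
Qed.

Lemma card_boundary_icecream_packing k m : k <= #|tgrid n| ->
  k * 2 <= m * m.-1 ->
  #|vertex_boundary (@tgrid_adj n) (icecream_packing n k)| <= m.
Proof.
move=> kN hk; apply: card_pos_inj => [v|u v].
  rewrite !inE => /andP[_ /existsP[w /andP[]]].
  rewrite !inE -/(rank w) -leqNgt => kw adj.
  have := rank_bound w; have := pos_row_le v; set r := n - row w => pv rw.
  (* The neighbour [w] in the cone has [pos w <= r], and [pos v] exceeds [pos w] by at most one;
     hence the extra unit. *)
  have rm : r.+1 < m.
    rewrite ltnNge; apply/negP => mr.
    have : m * m.-1 <= r.+1 * r by apply: leq_mul; lia.
    by lia.
  by move: adj; rewrite /tgrid_adj /tgrid_edge; have := pos_row_le w; lia.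
rewrite !inE !negbK -/(rank u) -/(rank v).
case/andP=> _ /existsP[w /andP[]]; rewrite !inE -/(rank w).
move=> wk adj /andP[kv _] epos.
rewrite leqNgt; apply/negP => ruv.
(* Dually, a neighbour [w] of the lower vertex [u] does not come after [v], so [w] in the cone would
   force [v] into it. *)
suff /leq_rank : ~~ row_lt v w by lia.
by move: adj; rewrite /tgrid_adj /tgrid_edge /row_lt; lia.
Qed.

End Grid.

Theorem theorem1 (n : nat) (hn : 1 <= n) (k : nat) (hk : k <= #|tgrid n|)
    (A : {set tgrid n}) (hA : #|A| = k) :
  minn #|vertex_boundary (@tgrid_adj n) (row_packing n k)|
       #|vertex_boundary (@tgrid_adj n) (icecream_packing n k)|
    <= #|vertex_boundary (@tgrid_adj n) A|.
Proof.
rewrite geq_min; apply/orP.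
case: (separation_dichotomy A) => h; [right | left].
  by apply: card_boundary_icecream_packing; rewrite // -hA.
by apply: card_boundary_row_packing => //; rewrite -hA -(cardsC A) addKn.
Qed.
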